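(* Let $L \in \mathbb{R}^{n\times n}$ be the combinatorial directed Laplacian of a directed weighted graph on $n$ vertices, and assume $L$ is diagonalizable, $L = V\Lambda V^{-1}$ with $V\in\mathbb{C}^{n\times n}$ invertible and $\Lambda$ diagonal. Let $M := V^*V$. Then for every $x \in \mathbb{C}^n$, with BGFT coefficients $\hat{x} := V^{-1}x$, one has $$\|x\|_2^2 = \hat{x}^* M \hat{x}.$$
   Context: Directed Laplacian: for a directed weighted graph on vertex set $\{1,\dots,n\}$ with real edge weights $w(i,j)$, the adjacency matrix $A\in\mathbb{R}^{n\times n}$ has $A_{ij}=w(i,j)$ if $(i,j)$ is an edge (oriented $i\to j$) and $A_{ij}=0$ otherwise; the out-degrees are $d_i^{\mathrm{out}}=\sum_{j=1}^n A_{ij}$, $D_{\mathrm{out}}=\operatorname{diag}(d_1^{\mathrm{out}},\dots,d_n^{\mathrm{out}})$, and $L := D_{\mathrm{out}}-A$. Eigendecomposition: $L$ is diagonalizable over $\mathbb{C}$: $L=V\Lambda V^{-1}$ with $V=[v_1,\dots,v_n]$ an invertible matrix of right eigenvectors, $Lv_k=\lambda_k v_k$, and $\Lambda=\operatorname{diag}(\lambda_1,\dots,\lambda_n)$. The eigenvectors need not be orthogonal or normalized. BGFT (Biorthogonal Graph Fourier Transform): the coefficient vector of $x\in\mathbb{C}^n$ is $\hat{x}=V^{-1}x$, so $x=V\hat{x}$. The matrix $M=V^*V$ is the Gram matrix of the right eigenvectors. $^*$ denotes conjugate transpose and $\|\cdot\|_2$ the Euclidean norm. *)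

(* Defs.v *)
From mathcomp Require Import all_boot all_order all_algebra.
From mathcomp Require Import complex reals.

Set Implicit Arguments.
Unset Strict Implicit.
Unset Printing Implicit Defensive.

Import Order.TTheory GRing.Theory Num.Theory.

Local Open Scope ring_scope.
Local Open Scope complex_scope.
Local Open Scope sesquilinear_scope.

(* Weights are arbitrary reals, possibly negative or zero, and self-loops are
   allowed; the value of [weight] off the edges is irrelevant. *)
Record wdigraph (R : realType) (n : nat) := WDigraph {
  edge : rel 'I_n;
  weight : 'I_n -> 'I_n -> R
}.

Definition adjmx (R : realType) (n : nat) (G : wdigraph R n) : 'M[R]_n :=
  \matrix_(i, j) (if edge G i j then weight G i j else 0).

Definition outdeg (R : realType) (n : nat) (G : wdigraph R n) : 'rV[R]_n :=
  \row_i \sum_j adjmx G i j.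

Definition dlaplacian (R : realType) (n : nat) (G : wdigraph R n) : 'M[R]_n :=
  diag_mx (outdeg G) - adjmx G.

Definition complexmx (R : realType) (m n : nat) (A : 'M[R]_(m, n)) :
    'M[R[i]]_(m, n) :=
  map_mx (real_complex R) A.

(* [invmx V] is the inverse of V only for V \in unitmx. *)
Definition bgft (R : realType) (n : nat) (V : 'M[R[i]]_n) (x : 'cV[R[i]]_n) :
    'cV[R[i]]_n :=
  invmx V *m x.

Definition grammx (R : realType) (n : nat) (V : 'M[R[i]]_n) : 'M[R[i]]_n :=
  V ^t* *m V.

(* The norm that MathComp-Analysis puts on matrices is the sup norm. *)
Definition l2norm (R : realType) (n : nat) (x : 'cV[R[i]]_n) : R :=
  Num.sqrt (\sum_i ComplexField.Normc.normc (x i 0) ^+ 2).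

(* Main.v *)
Require Import Defs.
From mathcomp Require Import all_boot all_order all_algebra.
From mathcomp Require Import complex reals.

Import Order.TTheory GRing.Theory Num.Theory.

Local Open Scope ring_scope.
Local Open Scope complex_scope.
Local Open Scope sesquilinear_scope.

(** The Gram matrix is the standard Hermitian form read in the coordinates of the basis [V]: by
    [l2norm_sqr] the squared norm is x^* x, and substituting x = V x̂ ([bgft_synthesis]) turns it
    into x̂^* (V^* V) x̂. *)

Lemma bgft_synthesis (R : realType) (n : nat) (V : 'M[R[i]]_n)
    (x : 'cV[R[i]]_n) :
  V \in unitmx -> V *m bgft V x = x.
Proof. by move=> V_unit; rewrite /bgft mulKVmx. Qed.

Lemma l2norm_sqr (R : realType) (n : nat) (x : 'cV[R[i]]_n) :
  (l2norm x ^+ 2)%:C = (x ^t* *m x) 0 0.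
Proof.
rewrite /l2norm sqr_sqrtr; last by apply: sumr_ge0 => i _; exact: sqr_ge0.
rewrite rmorph_sum mxE; apply: eq_bigr => i _.
(* The norm of [R[i]] is by definition [normc] embedded in [R[i]], so z z^* = |z|^2 closes the
   goal. *)
by rewrite !mxE rmorphXn [RHS]mulrC -normCK.
Qed.

Theorem theorem3p3 (R : realType) (n : nat) (G : wdigraph R n)
    (V Lambda : 'M[R[i]]_n)
    (V_unit : V \in unitmx) (Lambda_diag : is_diag_mx Lambda)
    (eigendec : complexmx (dlaplacian G) = V *m Lambda *m invmx V)
    (x : 'cV[R[i]]_n) :
  (l2norm x ^+ 2)%:C =
    ((bgft V x) ^t* *m grammx V *m bgft V x) 0 0.
Proof.
(* Only the two factors of x^* x are expanded; the [x] inside [bgft V x] on the right must stay. *)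
rewrite l2norm_sqr -{1 2}(bgft_synthesis _ _ _ x V_unit) /grammx.
by rewrite trmx_mul map_mxM !mulmxA.
Qed.
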